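(* Suppose $\lambda_0>1$. There exist positive constants $C,C'$ and an integer $N$, depending only on $T$, such that for every $k$ and every pair of admissible $(k+1)$-words $w_1,w_2$ with $d_1\ge N$ and $d_2\ge N$, the Perron–Frobenius eigenvalue $\lambda_1$ of $T_k\langle\{w_1,w_2\}\rangle$ satisfies $|\lambda_1-\lambda_0|\le C\lambda_0^{-k}\bigl(1+C'\lambda_0^{\delta}\bigr)$.
   Context: Let $\mathcal{A}$ be a finite alphabet of $r$ symbols and $T=(T_{x,y})$ an irreducible $r\times r$ matrix with entries in $\{0,1\}$ (the directed graph on $\mathcal{A}$ with an edge $x\to y$ iff $T_{y,x}=1$ is strongly connected), with Perron–Frobenius eigenvalue (spectral radius) $\lambda_0$. An admissible $k$-word is a string $a_1\cdots a_k$ with $T_{a_{i+1},a_i}=1$ for all $i$. $V_k$ is the complex vector space with basis $\{[w]\}$ indexed by admissible $k$-words; $\psi_k:V_1\to V_k$ is linear with $\psi_k([a])$ the sum of $[w]$ over admissible $k$-words beginning with $a$; $T_k:V_k\to V_k$ is linear with $T_k([a_1\cdots a_k])=\sum[a_2\cdots a_kx]$ over symbols $x$ with $a_2\cdots a_kx$ admissible. For a word $w$, $\beta w$, $\eta w$ are obtained by deleting the last, resp. first, symbol. For an admissible $(k+1)$-word $w$, $E_w:V_k\to V_k$ is linear with $E_w[\beta w]=[\eta w]$ and $E_w[u]=0$ for other admissible $k$-words $u$; for a set $\mathcal{C}$ of admissible $(k+1)$-words, $T_k\langle\mathcal{C}\rangle=T_k-\sum_{w\in\mathcal{C}}E_w$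 (a non-negative $0/1$ matrix in the word basis), whose Perron–Frobenius eigenvalue is its spectral radius. For an admissible $k$-word $u=u_1\cdots u_k$, $h(u)$ is the least non-negative integer $h$ such that $u$ is the only admissible $k$-word beginning with $u_1\cdots u_{h+1}$. For $w_1=a_0\cdots a_k$, $w_2=b_0\cdots b_k$: $d_1=h(a_1\cdots a_k)$, $h_2=h(b_1\cdots b_k)$; $W$ is the span of $\psi_k(V_1)$ and $T_k^i[a_1\cdots a_k]$, $0\le i\le d_1-1$; $d_2$ is the least non-negative integer with $T_k^{d_2}[b_1\cdots b_k]\in W$ (so $d_2\le h_2$); $\delta=h_2-d_2$. *)

(* Defs.v *)
(* Complex numbers are modelled by algC (algebraic complex
   numbers); all matrices involved have integer entries, so all eigenvalues
   are algebraic. *)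
From HB Require Import structures.
From mathcomp Require Import all_boot all_order all_algebra.
From mathcomp Require Import algC.
Set Implicit Arguments. Unset Strict Implicit. Unset Printing Implicit Defensive.
Import Order.TTheory GRing.Theory Num.Theory.
Local Open Scope ring_scope.

Section Words.
Variables (r : nat) (T : 'M[bool]_r).

Definition adm (s : seq 'I_r) : bool := sorted (fun a b => T b a) s.

Definition Wd (k : nat) := {w : k.-tuple 'I_r | adm w}.

Definition wseq k (u : Wd k) : seq 'I_r := val (val u).

Definition nW k := #|{: Wd k}|.
Definition wd k (i : 'I_(nW k)) : Wd k := enum_val i.

(* Matrices act on row vectors: entry (i, j) is the coefficient of [w_j]
   in the image of [w_i]. *)

Definition Tk k : 'M[algC]_(nW k) :=
  \matrix_(i, j) ([exists x : 'I_r,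
      wseq (wd j) == rcons (behead (wseq (wd i))) x] : nat)%:R.

Definition Ew k (w : seq 'I_r) : 'M[algC]_(nW k) :=
  \matrix_(i, j) (((wseq (wd i) == take (size w).-1 w)
                   && (wseq (wd j) == behead w)) : nat)%:R.

Definition TkC k (Cs : {set Wd k.+1}) : 'M[algC]_(nW k) :=
  Tk k - \sum_(w in Cs) Ew k (wseq w).

Definition Tmx : 'M[algC]_r := map_mx (fun b : bool => (b : nat)%:R) T.

(* [s] as a row vector of V_k (zero if s is not an admissible k-word) *)
Definition ebasis k (s : seq 'I_r) : 'rV[algC]_(nW k) :=
  \row_j ((wseq (wd j) == s) : nat)%:R.

Definition psi k (a : 'I_r) : 'rV[algC]_(nW k) :=
  \row_j ((take 1 (wseq (wd j)) == [:: a]) : nat)%:R.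

(* h(u): least h such that u is the only admissible k-word beginning with
   u_1 ... u_{h+1}; h = k always works, so searching in [0, k] is exact. *)
Definition hw k (s : seq 'I_r) : nat :=
  find (fun h => [forall v : Wd k,
          (take h.+1 (wseq v) == take h.+1 s) ==> (wseq v == s)])
       (iota 0 k.+1).

Definition Wsp k (s1 : seq 'I_r) : 'M[algC]_(nW k) :=
  (\sum_(a < r) <<psi k a>> + \sum_(i < hw k s1) <<ebasis k s1 *m Tk k ^+ i>>)%MS.

Definition is_d2 k (s1 s2 : seq 'I_r) (d2 : nat) : bool :=
  (ebasis k s2 *m Tk k ^+ d2 <= Wsp k s1)%MS
  && [forall d : 'I_d2, ~~ (ebasis k s2 *m Tk k ^+ d <= Wsp k s1)%MS].

End Words.

Definition PF_eig n (A : 'M[algC]_n) (l : algC) : Prop :=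
  (exists2 z, eigenvalue A z & `|z| = l) /\
  (forall z, eigenvalue A z -> `|z| <= l).

(* Main.v *)
Require Import Defs.
From HB Require Import structures.
From mathcomp Require Import all_boot all_order all_algebra.
From mathcomp Require Import algC ring.
Import Order.TTheory GRing.Theory Num.Theory.
Local Open Scope ring_scope.

(* Let v be the Perron vector of T, normalised so that v >= 1, and weight a k-word by
   the value of v at its last letter: f is an eigenvector of T_k for l0. Pairing an
   eigenvector of A = T_k<C> with f gives l1 <= l0. For the converse bound, follow a
   row vector y_n along T_k for k steps and then along A; the loss in
   Z_n = y_n f at each step is the mass on the removed transitions, which is at most
   c Z_(n-k) because T_k^k has entries at most 1. So Z_(n+1) >= l0 Z_n - c Z_(n-k), and
   Z grows at least at rate b = l0 - 2 c l0^-k. This gives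
   |l1 - l0| <= 2 c l0^-k for all large k, and the factor 1 + C' l0^delta is at least 1. *)

(** * Exponential growth from Bernoulli's inequality *)

Lemma bernoulli_ge (e : algC) n : 0 <= e -> 1 + e *+ n <= (1 + e) ^+ n.
Proof.
move=> e0; elim: n => [|n IH]; first by rewrite addr0 expr0.
rewrite exprSr; apply: (le_trans _ (ler_wpM2r _ IH)); last exact: addr_ge0.
rewrite mulrSr addrA mulrDr mulr1 lerD2l mulrDl mul1r lerDl.
by rewrite mulr_ge0 ?mulrn_wge0.
Qed.

Lemma exp_unbounded (q : algC) (B : algC) : 1 < q -> B \is Num.real ->
  exists n, B < q ^+ n.
Proof.
move=> q1 Br; have e0 : 0 < q - 1 by rewrite subr_gt0.
have Bn : 0 <= `|B| / (q - 1) by rewrite divr_ge0 // ltW.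
exists (Num.Def.archi_bound (`|B| / (q - 1))).
have := archi_boundP Bn; rewrite ltr_pdivrMr // => /(le_lt_trans (real_ler_norm Br)) h.
apply: (lt_le_trans h); rewrite mulr_natl -[X in X ^+ _](subrK 1 q) [_ - 1 + 1]addrC.
by apply: (le_trans _ (bernoulli_ge _ _ (ltW e0))); rewrite lerDr.
Qed.

Lemma growth_le (b rho c D : algC) : 0 < c -> 0 < rho -> 
  (forall n, c * b ^+ n <= D * rho ^+ n) -> ~~ (rho < b).
Proof.
move=> c0 rho0 h; apply/negP => rb.
have q1 : 1 < b / rho by rewrite ltr_pdivlMr // mul1r.
(* The order on [algC] is partial: the bound at [n = 0] compares [D] with the real [c], which makes
   [D] real. *)
have Dr : D \is Num.real.
  by have := h 0%N; rewrite !expr0 !mulr1 => /ger_real ->; rewrite gtr0_real.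
have [|n hn] := exp_unbounded (b / rho) (D / c) q1.
  by rewrite rpredM // rpredV gtr0_real.
have := h n; rewrite -ler_pdivrMr ?exprn_gt0 // -mulrA -expr_div_n.
rewrite mulrC -ler_pdivlMr // => h1.
by have := lt_le_trans hn h1; rewrite ltxx.
Qed.

(** * Growth of orbits and the spectral radius *)

Definition norm1 {n} (x : 'rV[algC]_n) := \sum_j `|x 0 j|.

Lemma norm1_ge0 n (x : 'rV[algC]_n) : 0 <= norm1 x.
Proof. exact: sumr_ge0. Qed.

Lemma norm1_lin n (a : algC) (x y : 'rV[algC]_n) :
  norm1 (a *: x + y) <= `|a| * norm1 x + norm1 y.
Proof.
rewrite /norm1 mulr_sumr -big_split /=; apply: ler_sum => j _.
by rewrite !mxE -normrM ler_normD.
Qed.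

(* Peeling off one eigenvalue [z] at a time: y = x (M - z) satisfies the bound by
   induction, and x M^(n+1) = z x M^n + y M^n. *)
Lemma norm1_pow_bound_prod n (M : 'M[algC]_n.+1) (rho : algC) (zs : seq algC) :
  {in zs, forall z, `|z| < rho} ->
  forall x : 'rV_n.+1, x *m horner_mx M (\prod_(z <- zs) ('X - z%:P)) = 0 ->
  exists2 D : algC, 0 <= D & forall m, norm1 (x *m M ^+ m) <= D * rho ^+ m.
Proof.
elim: zs => [|z zs IH] hz x.
  rewrite big_nil rmorph1 mulmx1 => ->; exists 0 => // m.
  by rewrite mul0mx mul0r /norm1 big1 // => j _; rewrite mxE normr0.
have zr : `|z| < rho by apply: hz; rewrite inE eqxx.
have rho_ge0 : 0 <= rho := le_trans (normr_ge0 z) (ltW zr).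
rewrite big_cons rmorphM rmorphB /= horner_mx_X horner_mx_C mulmxA => xz.
have [|D D0 hD] := IH _ _ xz; first by move=> y yzs; apply: hz; rewrite inE yzs orbT.
have gap : 0 < rho - `|z| by rewrite subr_gt0.
(* The first term serves [m = 0]; the second gives [|z| E + D <= rho E], which closes the
   induction. *)
set E := norm1 x + D / (rho - `|z|).
have E0 : 0 <= E by apply: addr_ge0; [exact: norm1_ge0 | rewrite divr_ge0 // ltW].
exists E => //; elim=> [|m IHm].
  by rewrite !expr0 mulmx1 mulr1 lerDl divr_ge0 // ltW.
have -> : x *m M ^+ m.+1 = z *: (x *m M ^+ m) + x *m (M - z%:M) *m M ^+ m.
  rewrite mulmxBr mulmxBl mul_mx_scalar -scalemxAl addrC subrK.
  by rewrite exprS -mulmxE mulmxA.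
apply: (le_trans (norm1_lin _ _ _ _)).
apply: (@le_trans _ _ (`|z| * (E * rho ^+ m) + D * rho ^+ m)).
  by apply: lerD (hD m); apply: ler_wpM2l.
rewrite mulrA -mulrDl exprS mulrA; apply: ler_wpM2r; first exact: exprn_ge0.
rewrite addrC -lerBrDr [`|z| * E]mulrC -mulrBr -ler_pdivrMr //.
by rewrite lerDr norm1_ge0.
Qed.

(** The characteristic polynomial splits over [algC], its roots are the eigenvalues, and it kills
    [M] by Cayley-Hamilton. *)
Lemma norm1_pow_bound n (M : 'M[algC]_n) (rho : algC) :
  (forall z, eigenvalue M z -> `|z| < rho) ->
  forall x : 'rV_n, exists2 D : algC, 0 <= D & forall m, norm1 (x *m M ^+ m) <= D * rho ^+ m.
Proof.
case: n M => [|n] M hM x.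
  by exists 0 => // m; rewrite mul0r /norm1 big_ord0.
have [zs hzs] := closed_field_poly_normal (char_poly M).
move: hzs; rewrite (monicP (char_poly_monic M)) scale1r => hzs.
apply: (@norm1_pow_bound_prod _ _ _ zs).
  move=> z zzs; apply: hM; rewrite eigenvalue_root_char hzs root_prod_XsubC.
  exact: zzs.
by rewrite -hzs Cayley_Hamilton mulmx0.
Qed.

(** If [l < b], take [rho] halfway: the orbit of [x], hence its pairing with [f], is O([rho^m]),
    against the lower bound [c b^m]. *)
Lemma spectral_radius_ge n (M : 'M[algC]_n) (l b c : algC)
    (x : 'rV_n) (f : 'cV_n) :
  PF_eig M l -> 0 < c -> b \is Num.real ->
  (forall m, c * b ^+ m <= `|(x *m M ^+ m *m f) 0 0|) -> b <= l.
Proof.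
move=> [[z _ zl] hl] c0 br h; have l0 : 0 <= l by rewrite -zl.
have lr := ger0_real l0; rewrite real_leNgt //; apply/negP => lb.
have [l1 l2] := midf_lt lb; set rho := (l + b) / 2 in l1 l2.
have rho0 : 0 < rho by apply: le_lt_trans l1.
have [|D D0 hD] := @norm1_pow_bound _ M rho _ x.
  by move=> y /hl/le_lt_trans; apply.
suff : ~~ (rho < b) by rewrite l2.
apply: (@growth_le _ _ c (D * norm1 f^T)) => // m; apply: (le_trans (h m)); rewrite mulrAC.
apply: (@le_trans _ _ (norm1 (x *m M ^+ m) * norm1 f^T)); last first.
  by apply: ler_wpM2r (hD m); exact: norm1_ge0.
rewrite mxE; apply: (le_trans (ler_norm_sum _ _ _)).
rewrite /norm1 mulr_suml; apply: ler_sum => j _; rewrite normrM.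
apply: ler_wpM2l => //; rewrite (bigD1 j) //= mxE lerDl.
exact: sumr_ge0.
Qed.

(** * Non-negative matrices and the Perron vector *)

Lemma mulmx_ge0 m n p (A : 'M[algC]_(m, n)) (B : 'M_(n, p)) :
  (forall i j, 0 <= A i j) -> (forall i j, 0 <= B i j) ->
  forall i j, 0 <= (A *m B) i j.
Proof.
by move=> A0 B0 i j; rewrite mxE; apply: sumr_ge0 => t _; rewrite mulr_ge0.
Qed.

Lemma exp_mx_ge0 n (A : 'M[algC]_n) m :
  (forall i j, 0 <= A i j) -> forall i j, 0 <= (A ^+ m) i j.
Proof.
move=> A0; elim: m => [|m IH]; first by move=> i j; rewrite expr0 mxE ler0n.
by move=> i j; rewrite exprS; apply: mulmx_ge0.
Qed.

Lemma ler_mulmx2r m n p (A B : 'M[algC]_(m, n)) (M : 'M_(n, p)) :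
  (forall i j, 0 <= M i j) -> (forall i j, A i j <= B i j) ->
  forall i j, (A *m M) i j <= (B *m M) i j.
Proof.
by move=> M0 AB i j; rewrite !mxE; apply: ler_sum => t _; rewrite ler_wpM2r.
Qed.

Lemma ler_mulmx2l m n p (M : 'M[algC]_(m, n)) (A B : 'M_(n, p)) :
  (forall i j, 0 <= M i j) -> (forall i j, A i j <= B i j) ->
  forall i j, (M *m A) i j <= (M *m B) i j.
Proof.
by move=> M0 AB i j; rewrite !mxE; apply: ler_sum => t _; rewrite ler_wpM2l.
Qed.

(** Iteration gives [y M^m >= b^m y] entrywise; coordinate [i] then grows at least like [b^m]. *)
Lemma subinvariant_le n (M : 'M[algC]_n) (l b : algC) (y : 'rV_n) i :
  (forall i j, 0 <= M i j) -> PF_eig M l -> 0 <= b ->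
  (forall j, 0 <= y 0 j) -> 0 < y 0 i ->
  (forall j, b * y 0 j <= (y *m M) 0 j) -> b <= l.
Proof.
move=> M0 hl b0 y0 yi hy.
have hm m j : b ^+ m * y 0 j <= (y *m M ^+ m) 0 j.
  elim: m j => [|m IH] j; first by rewrite !expr0 mul1r mulmx1.
  rewrite exprSr [M ^+ m.+1]exprSr -mulrA mulmxA.
  apply: (@le_trans _ _ (b ^+ m * (y *m M) 0 j)).
    by rewrite ler_wpM2l ?exprn_ge0.
  have -> : b ^+ m * (y *m M) 0 j = ((b ^+ m *: y) *m M) 0 j.
    by rewrite -scalemxAl [RHS]mxE.
  apply: ler_mulmx2r => // i' j'; rewrite ord1 mxE; exact: IH.
apply: (@spectral_radius_ge _ M l b (y 0 i) y (delta_mx i 0)) => //.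
  exact: ger0_real.
move=> m; rewrite -colE mxE mulrC; apply: (le_trans (hm m i)).
by apply: real_ler_norm; rewrite ger0_real // (le_trans _ (hm m i)) // mulr_ge0 ?exprn_ge0.
Qed.

Lemma dominating_factor n (y w : 'rV[algC]_n) :
  (forall j, 0 < y 0 j) -> (forall j, 0 < w 0 j) -> 
  exists2 e, 0 < e & forall j, e * y 0 j <= w 0 j.
Proof.
move=> y0 w0; pose s := 1 + \sum_j y 0 j / w 0 j.
have t0 j : 0 <= y 0 j / w 0 j by rewrite divr_ge0 // ltW.
have s0 : 0 < s by rewrite ltr_wpDr ?sumr_ge0.
exists s^-1; rewrite ?invr_gt0 // => j.
rewrite mulrC ler_pdivrMr // mulrC -ler_pdivrMr // /s (bigD1 j) //=.
by rewrite addrCA lerDl addr_ge0 ?sumr_ge0.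
Qed.

(* If |x| M - l |x| were nonzero, multiplying it by a positive matrix commuting with
   M would give growth rate strictly larger than l. *)
Lemma perron_frobenius n (M : 'M[algC]_n) (l : algC) :
  (forall i j, 0 <= M i j) -> (forall i j, exists m, 0 < (M ^+ m) i j) ->
  PF_eig M l -> exists2 v : 'rV_n, v *m M = l *: v & forall j, 1 <= v 0 j.
Proof.
move=> M0 Mirr hl; have [[z /eigenvalueP[x xM x0] zl] _] := hl.
have l0 : 0 <= l by rewrite -zl.
have [f hf] : exists f : 'I_n * 'I_n -> nat, forall p, 0 < (M ^+ f p) p.1 p.2.
  by apply: (@fin_all_exists _ (fun=> nat) (fun p m => 0 < (M ^+ m) p.1 p.2)) => -[i j] /=.
pose P := \sum_p M ^+ f p.
have P0 i j : 0 < P i j.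
  rewrite /P summxE (bigD1 (i, j)) //= ltr_wpDr ?hf //.
  by apply: sumr_ge0 => p _; apply: exp_mx_ge0.
have PM : P *m M = M *m P.
  rewrite /P mulmx_suml mulmx_sumr; apply: eq_bigr => p _.
  by rewrite mulmxE -exprS exprSr.
have posP (y : 'rV[algC]_n) : (forall j, 0 <= y 0 j) -> y != 0 -> forall j, 0 < (y *m P) 0 j.
  move=> y0 /rV0Pn[i yi] j; rewrite mxE (bigD1 i) //= ltr_wpDr //.
    by apply: sumr_ge0 => t _; rewrite mulr_ge0 // ltW.
  by rewrite mulr_gt0 // lt_def yi y0.
pose a : 'rV[algC]_n := \row_j `|x 0 j|.
have a0 j : 0 <= a 0 j by rewrite mxE.
have an0 : a != 0.
  by have /rV0Pn[i xi] := x0; apply/rV0Pn; exists i; rewrite mxE normr_eq0.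
have sub j : l * a 0 j <= (a *m M) 0 j.
  rewrite mxE -zl -normrM.
  have -> : z * x 0 j = (x *m M) 0 j by rewrite xM mxE.
  rewrite !mxE; apply: (le_trans (ler_norm_sum _ _ _)); apply: ler_sum => t _.
  by rewrite normrM !mxE (ger0_norm (M0 _ _)).
have aM : a *m M = l *: a.
  apply/eqP; rewrite -subr_eq0; apply/negPn/negP => d0.
  set d := _ - _ in d0.
  have dge j : 0 <= d 0 j.
    have -> : d 0 j = (a *m M) 0 j - l * a 0 j by rewrite !mxE.
    by rewrite subr_ge0.
  have yP := posP _ a0 an0; have dP := posP _ dge d0.
  have [e e0 he] := dominating_factor _ _ _ yP dP.
  have /rV0Pn[i _] := an0.
  (* Since [a P M = l a P + d P] and [d P >= e a P], the vector [a P] is subinvariant at rate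
     [l + e]. *)
  have : l + e <= l.
    apply: (@subinvariant_le _ M l (l + e) (a *m P) i) => //.
    - by rewrite addr_ge0 // ltW.
    - by move=> j; apply: ltW.
    move=> j; rewrite mulrDl -mulmxA PM mulmxA.
    have -> : a *m M = l *: a + d by rewrite /d addrC subrK.
    by rewrite mulmxDl -scalemxAl [X in _ <= X]mxE [X in _ <= X + _]mxE lerD2l.
  by rewrite gerDl => /(lt_le_trans e0); rewrite ltxx.
(* Every power of [M] scales [a], so [a P] is a multiple of [a]; it has no zero entry, hence neither
   has [a]. *)
have apos j : 0 < a 0 j.
  have aMm m : a *m M ^+ m = l ^+ m *: a.
    elim: m => [|m IH]; first by rewrite !expr0 mulmx1 scale1r.
    by rewrite exprSr mulmxA IH -scalemxAl aM scalerA -exprSr.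
  have := posP _ a0 an0 j.
  rewrite /P mulmx_sumr (eq_bigr (fun p => l ^+ f p *: a)); last by move=> p _; exact: aMm.
  rewrite -scaler_suml mxE => h; rewrite lt_def a0 andbT; apply/eqP => aj.
  by rewrite aj mulr0 ltxx in h.
pose o : 'rV[algC]_n := \row_j 1.
have [|e e0 he] := dominating_factor _ o a _ apos; first by move=> j; rewrite mxE.
exists (e^-1 *: a); first by rewrite -scalemxAl aM !scalerA mulrC.
by move=> j; rewrite mxE mulrC ler_pdivlMr // mul1r; have := he j; rewrite mxE mulr1.
Qed.

(** * Lower and upper bounds for the perturbed spectral radius *)

Lemma bernoulli_sub (e : algC) n : 0 <= e <= 1 -> 1 - e *+ n <= (1 - e) ^+ n.
Proof.
move=> /andP[e0 e1]; elim: n => [|n IH]; first by rewrite subr0 expr0.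
rewrite exprSr; apply: (le_trans _ (ler_wpM2r _ IH)); last by rewrite subr_ge0.
rewrite mulrBr mulr1 mulrBl mul1r mulrSr opprD addrA opprB addrCA lerDr.
by rewrite mulr_ge0 ?mulrn_wge0.
Qed.

(** Bernoulli for [p = sqrtC q] gives [p^k >= k (p - 1)]; its square beats [D k] once
    [k >= D / (p - 1)^2]. *)
Lemma exp_gt_linear (q D : algC) : 1 < q -> 0 <= D ->
  exists K, forall k, (K <= k)%N -> D *+ k <= q ^+ k.
Proof.
move=> q1 D0; have q0 : 0 <= q := le_trans ler01 (ltW q1).
have p1 : 1 < sqrtC q by rewrite -sqrtC1 ltr_sqrtC ?qualifE /= ?ler01.
set e := sqrtC q - 1; have e0 : 0 < e by rewrite subr_gt0.
have De0 : 0 <= D / e ^+ 2 by rewrite divr_ge0 // exprn_ge0 // ltW.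
exists (Num.Def.archi_bound (D / e ^+ 2)) => k kK.
have := archi_boundP De0; rewrite ltr_pdivrMr ?exprn_gt0 // => /ltW h.
have ek : e *+ k <= sqrtC q ^+ k.
  rewrite -[X in X ^+ _](subrK 1 (sqrtC q)) [_ - 1 + 1]addrC.
  by apply: (le_trans _ (bernoulli_ge _ _ (ltW e0))); rewrite lerDr.
rewrite -[q]sqrtCK -exprM mulnC exprM.
apply: (@le_trans _ _ ((e *+ k) ^+ 2)); last first.
  by rewrite !expr2 ler_pM // mulrn_wge0 // ltW.
rewrite -mulr_natl -(mulr_natl e) exprMn (expr2 k%:R) -mulrA ler_wpM2l ?ler0n //.
apply: (le_trans h); rewrite ler_wpM2r ?ler_nat //.
by rewrite exprn_ge0 // ltW.
Qed.

(* With e = 2 c l^-(k+1), Bernoulli gives (1 - e)^k >= 1 - k e >= 1/2 for large k. *)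
Lemma perturbed_root (l c : algC) : 1 < l -> 0 < c ->
  exists K, forall k, (K <= k)%N ->
    let b := l - 2 * c * l ^- k in 0 < b /\ c <= (l - b) * b ^+ k.
Proof.
move=> l1 c0; have l0 : 0 < l := lt_trans ltr01 l1.
have D0 : 0 <= 4 * c by rewrite mulr_ge0 ?ler0n // ltW.
have [K hK] := exp_gt_linear l (4 * c) l1 D0.
exists K.+1 => k kK /=; have k0 : (0 < k)%N by apply: leq_trans kK.
have lk : 0 < l ^+ k by rewrite exprn_gt0.
have lk1 : 0 < l ^+ k.+1 by rewrite exprn_gt0.
have hk : (4 * c) *+ k <= l ^+ k.+1.
  apply: (le_trans (hK k (ltnW kK))); rewrite exprS ler_peMl ?ltW //.
set e := 2 * c / l ^+ k.+1.
have e0 : 0 <= e by rewrite divr_ge0 ?ltW // mulr_gt0 ?ltr0n.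
have ek : e *+ k <= 2^-1.
  rewrite -mulr_natr mulrAC ler_pdivrMr // [2^-1 * _]mulrC ler_pdivlMr ?ltr0n //.
  apply: le_trans hk; rewrite le_eqVlt; apply/orP; left; apply/eqP.
  by rewrite -mulr_natr -[4]/((2 * 2)%:R) natrM; ring.
have e1 : e <= 2^-1.
  apply: le_trans ek; case: (k) k0 => // n _.
  by rewrite mulrS lerDl mulrn_wge0.
have h1 : 2^-1 < 1 :> algC by rewrite invf_lt1 ?ltr0n // ltr1n.
have bE : l - 2 * c * l ^- k = l * (1 - e).
  by rewrite /e exprS; field; rewrite !gt_eqF.
split; first by rewrite bE mulr_gt0 // subr_gt0 (le_lt_trans e1).
(* As [b = l (1 - e)], the powers of [l] cancel and the claim becomes [1/2 <= (1 - e)^k]. *)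
rewrite opprB addrCA subrr addr0 bE exprMn mulrA divfK ?gt_eqF //.
rewrite -ler_pdivrMl ?mulr_gt0 ?ltr0n // invfM mulfVK ?gt_eqF //.
apply: (le_trans _ (bernoulli_sub _ _ _)); last by rewrite e0 (le_trans e1) ?ltW.
rewrite lerBrDr -lerBrDl; apply: (le_trans ek); rewrite lerBrDr.
by rewrite -[2^-1]mul1r -splitr.
Qed.

(* The weighted count Z_n = y_n f along the orbit y_n that follows B for the first k
   steps and A afterwards satisfies Z_(n+1) >= l Z_n, with an error at most
   c Z_(n-k) when n >= k; this yields Z_(n+1) >= b Z_n by strong induction. *)
Lemma perturbation_lower_bound n (A B : 'M[algC]_n) (f g : 'cV_n) (k : nat)
    (l b c l1 : algC) :
  (forall i j, 0 <= A i j) -> (forall i j, A i j <= B i j) ->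
  (forall i, 1 <= f i 0) -> B *m f = l *: f -> A *m f = l *: f - g ->
  (forall i, 0 <= g i 0) -> \sum_i g i 0 <= c -> 
  (forall i j, (B ^+ k) i j <= 1) ->
  0 < b -> b <= l -> c <= (l - b) * b ^+ k ->
  PF_eig A l1 -> b <= l1.
Proof.
move=> A0 AB f1 Bf Af g0 gc Bk b0 bl cb hl1.
have B0 i j : 0 <= B i j := le_trans (A0 i j) (AB i j).
have f0 i j : 0 <= f i j by rewrite ord1 (le_trans ler01).
have [u _] : exists u : 'I_n, true.
  have [[z /eigenvalueP[x _ /rV0Pn[u _]] _] _] := hl1; by exists u.
pose y := fix y m : 'rV[algC]_n :=
  if m is m'.+1 then y m' *m (if (m' < k)%N then B else A) else delta_mx 0 u.
have ySE m : y m.+1 = y m *m (if (m < k)%N then B else A) by [].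
have y0 m i j : 0 <= y m i j.
  elim: m i j => [|m IH] i j; first by rewrite mxE ler0n.
  by rewrite ySE; apply: mulmx_ge0 => // i' j'; case: ifP.
have yB m t i j : y (m + t)%N i j <= (y m *m B ^+ t) i j.
  elim: t i j => [|t IH] i j; first by rewrite addn0 expr0 mulmx1.
  rewrite addnS ySE exprSr mulmxA.
  apply: (@le_trans _ _ ((y (m + t)%N *m B) i j)).
    by apply: ler_mulmx2l => // i' j'; case: ifP.
  by apply: ler_mulmx2r.
have yA m : y (k + m)%N = y k *m A ^+ m.
  elim: m => [|m IH]; first by rewrite addn0 expr0 mulmx1.
  by rewrite addnS ySE ltnNge leq_addr /= IH exprSr mulmxA.
pose Z m := (y m *m f) 0 0.
have Z0 m : 0 <= Z m by apply: mulmx_ge0.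
have step m : b * Z m <= Z m.+1.
  have [p mp] := ubnP m; elim: p m mp => // p IH m mp.
  have [mk|km] := ltnP m k.
    rewrite /Z ySE mk -mulmxA Bf -scalemxAr [X in _ <= X]mxE.
    by rewrite ler_wpM2r //; apply: Z0.
  rewrite /Z ySE ltnNge km /= -mulmxA Af mulmxBr -scalemxAr.
  rewrite [X in _ <= X]mxE [X in _ <= X + _]mxE [X in _ <= _ + X]mxE -/(Z m).
  (* This reduces the step to bounding the loss [y_m g] by [(l - b) Z_m]. *)
  rewrite lerBrDr -lerBrDl -mulrBl.
  (* The induction hypothesis at the [k] preceding times chains to [b^k Z_(m-k) <= Z_m]. *)
  have pow t : (t <= k)%N -> b ^+ t * Z (m - k)%N <= Z (m - k + t)%N.
    elim: t => [|t IHt] tk; first by rewrite expr0 mul1r addn0.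
    rewrite exprS -mulrA addnS; apply: (le_trans _ (IH _ _)).
      by apply: ler_wpM2l (IHt (ltnW tk)); apply: ltW.
    rewrite -ltnS; apply: leq_trans mp; rewrite ltnS -[X in (_ < X)%N](subnK km).
    by rewrite ltn_add2l.
  have hk := pow _ (leqnn k); rewrite subnK // in hk.
  apply: (@le_trans _ _ (c * Z (m - k)%N)); last first.
    apply: (@le_trans _ _ ((l - b) * b ^+ k * Z (m - k)%N)).
      by rewrite ler_wpM2r.
    by rewrite -mulrA ler_wpM2l // subr_ge0.
  rewrite -{1}(subnK km).
  apply: (@le_trans _ _ ((y (m - k)%N *m B ^+ k *m g) 0 0)).
    by apply: ler_mulmx2r => [i j|]; rewrite ?ord1.
  (* Termwise: [(B^k g)_i <= \sum_j g_j <= c], while [y_i <= y_i f_i] because [f_i >= 1]. *)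
  rewrite -mulmxA [leLHS]mxE /Z [X in c * X]mxE mulr_sumr; apply: ler_sum => i _.
  rewrite mulrC; apply: ler_pM => //; last by rewrite ler_peMr.
    by apply: mulmx_ge0 => [|i' j']; rewrite ?ord1 //; apply: exp_mx_ge0.
  apply: le_trans gc; rewrite mxE; apply: ler_sum => j _.
  by rewrite ler_piMl.
have Zpow m : b ^+ m * Z 0%N <= Z m.
  elim: m => [|m IH]; first by rewrite expr0 mul1r.
  by apply: le_trans (step m); rewrite exprS -mulrA ler_wpM2l // ltW.
have Z00 : 0 < Z 0%N.
  by rewrite /Z -rowE mxE (lt_le_trans ltr01).
(* From time [k] on the orbit is driven by [A] alone, so the comparison starts at [y k]. *)
apply: (@spectral_radius_ge _ A l1 b (b ^+ k * Z 0%N) (y k) f) => //.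
- by rewrite mulr_gt0 ?exprn_gt0.
- exact: gtr0_real.
move=> m; rewrite -yA mulrAC -exprD ger0_norm ?Z0 //; exact: Zpow.
Qed.

(** For an eigenvector [x], [|z| |x| <= |x| A] entrywise; pairing with [f] and cancelling
    [|x| f > 0] leaves [|z| <= l]. *)
Lemma eigenvalue_le n (A : 'M[algC]_n) (f : 'cV_n) (l z : algC) :
  (forall i j, 0 <= A i j) -> (forall i, 0 < f i 0) ->
  (forall i, (A *m f) i 0 <= l * f i 0) -> eigenvalue A z -> `|z| <= l.
Proof.
move=> A0 f0 Af /eigenvalueP[x xA /rV0Pn[i xi]].
have s0 : 0 < \sum_j `|x 0 j| * f j 0.
  rewrite (bigD1 i) //= ltr_wpDr ?mulr_gt0 ?normr_gt0 //.
  by apply: sumr_ge0 => j _; rewrite mulr_ge0 // ltW.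
rewrite -(ler_pM2r s0) !mulr_sumr.
apply: (@le_trans _ _ (\sum_j (\sum_t `|x 0 t| * A t j) * f j 0)).
  apply: ler_sum => j _; rewrite mulrA -normrM; apply: ler_wpM2r; first exact: ltW.
  have -> : z * x 0 j = (x *m A) 0 j by rewrite xA mxE.
  rewrite mxE; apply: (le_trans (ler_norm_sum _ _ _)); apply: ler_sum => t _.
  by rewrite normrM (ger0_norm (A0 _ _)).
rewrite (eq_bigr _ (fun j _ => mulr_suml _ _ _ _)) exchange_big /=.
apply: ler_sum => t _; rewrite mulrCA.
apply: (@le_trans _ _ (`|x 0 t| * (A *m f) t 0)); last by rewrite ler_wpM2l.
by rewrite mxE mulr_sumr le_eqVlt; apply/orP; left; apply/eqP/eq_bigr => j _; rewrite mulrA.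
Qed.

(** * Words and their transition matrices *)

Lemma sum_inj_le1 (I : finType) (S : eqType) (g : I -> S) (P : pred I) (s : S) :
  injective g -> \sum_(i | P i) ((g i == s) : nat)%:R <= 1 :> algC.
Proof.
move=> g_inj; rewrite -natr_sum -[1]/(1%:R) ler_nat.
rewrite (eq_bigr (fun i => if g i == s then 1 else 0)%N) => [|i _]; last by case: eqP.
rewrite -big_mkcondr sum1dep_card.
apply/card_le1_eqP => i j; rewrite !inE => /andP[_ /eqP gi] /andP[_ /eqP gj].
by apply: g_inj; rewrite gi.
Qed.

Section Words.
Variables (r : nat) (T : 'M[bool]_r) (x0 : 'I_r).

Lemma wseq_inj k : injective (@wseq r T k).
Proof. by move=> u v /val_inj/val_inj. Qed.

Lemma size_wseq {k} (u : Wd T k) : size (wseq u) = k.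
Proof. exact: size_tuple. Qed.

Lemma wd_inj k : injective (fun i : 'I_(nW T k) => wseq (wd i)).
Proof. by move=> i j /wseq_inj/enum_val_inj. Qed.

Lemma sum_word_eq k (s : seq 'I_r) : size s = k ->
  \sum_(j < nW T k) ((wseq (wd j) == s) : nat)%:R = (adm T s : nat)%:R :> algC.
Proof.
move=> sk; case: (boolP (adm T s)) => [sa|sna]; last first.
  rewrite big1 // => j _; case: eqP => // js.
  by move: sna; rewrite -js (valP (wd j)).
have sz : size s == k by apply/eqP.
pose w : Wd T k := exist _ (Tuple sz) sa.
have wE : wseq (wd (enum_rank w)) = s by rewrite /wd enum_rankK.
rewrite (bigD1 (enum_rank w)) //= wE eqxx big1 ?addr0 // => j jw.
case: eqP => // js; case/negP: jw; apply/eqP/wd_inj => /=.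
by rewrite js wE.
Qed.

(** Length at least 2 keeps the last letter of [u] in its tail. *)
Lemma adm_rcons_behead k (u : Wd T k.+2) x :
  adm T (rcons (behead (wseq u)) x) = T x (last x0 (wseq u)).
Proof.
have := valP u; rewrite -/(wseq u); have := size_wseq u.
case: (wseq u) => [|a [|b s]] //= _ /andP[_ ps].
by rewrite /adm /= rcons_path ps.
Qed.

Lemma Tk_entry k (i j : 'I_(nW T k)) :
  Tk T k i j = \sum_x ((wseq (wd j) == rcons (behead (wseq (wd i))) x) : nat)%:R.
Proof.
rewrite mxE; case: existsP => [[x /eqP jx]|nx]; last first.
  by rewrite big1 // => x _; case: eqP => // jx; case: nx; exists x; apply/eqP.
rewrite (bigD1 x) //= jx eqxx big1 ?addr0 // => y yx.
by rewrite eqseq_rcons eqxx /= eq_sym (negPf yx).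
Qed.

(** [T x y] marks an edge from [y] to [x], so [v *m Tmx T] sums [v] over successors; this is why [v]
    is a row. *)
Definition last_weight (v : 'rV[algC]_r) k : 'cV[algC]_(nW T k) :=
  \col_i v 0 (last x0 (wseq (wd i))).

(* Words of length at least 2: T_1 sends every letter to the sum of all letters. *)
Lemma Tk_last_weight (v : 'rV[algC]_r) (l : algC) k : v *m Tmx T = l *: v ->
  Tk T k.+2 *m last_weight v k.+2 = l *: last_weight v k.+2.
Proof.
move=> vT; apply/colP => i; rewrite [RHS]mxE [in RHS]mxE.
have -> : l * v 0 (last x0 (wseq (wd i))) = (v *m Tmx T) 0 (last x0 (wseq (wd i))).
  by rewrite vT mxE.
rewrite !mxE.
under eq_bigr => j _.
  rewrite Tk_entry mulr_suml.
  under eq_bigr => x _.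
    have -> : ((wseq (wd j) == rcons (behead (wseq (wd i))) x) : nat)%:R
                * last_weight v k.+2 j 0
           = v 0 x * ((wseq (wd j) == rcons (behead (wseq (wd i))) x) : nat)%:R.
      case: eqP => [jx|_]; last by rewrite mul0r mulr0.
      by rewrite mxE jx last_rcons mulrC.
    over.
  over.
rewrite exchange_big /=; apply: eq_bigr => x _; rewrite -mulr_sumr mxE.
rewrite sum_word_eq ?adm_rcons_behead //.
by rewrite size_rcons size_behead size_wseq.
Qed.

(** A successor of [u] determines all of [u] but its first letter, and the prefix condition forces
    that letter. *)
Lemma shift_word k m (s u : seq 'I_r) x :
  size s = k -> size u = k -> (m < k)%N -> take (k - m) u = drop m s ->
  u = nth x0 s m :: take k.-1 (rcons (behead u) x)
  /\ take (k - m.+1) (rcons (behead u) x) = drop m.+1 s.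
Proof.
case: k => // k sk; case: u => // a u [uk]; rewrite ltnS => mk.
rewrite (drop_nth x0) ?sk // subSn //= subSS => -[-> tm].
by rewrite -cats1 take_size_cat // takel_cat ?uk ?leq_subr.
Qed.

(* In T^m [u] only words starting with u_(m+1) ... u_k occur, and each occurs once. *)
Lemma Tk_pow_entry k m (i j : 'I_(nW T k)) : (m <= k)%N ->
  (Tk T k ^+ m) i j <= ((take (k - m) (wseq (wd j)) == drop m (wseq (wd i))) : nat)%:R.
Proof.
elim: m j => [|m IH] j mk.
  rewrite expr0 mxE subn0 drop0 -[X in take X (wseq (wd j))](size_wseq (wd j)) take_size.
  by rewrite (inj_eq (@wd_inj k)) eq_sym.
rewrite exprSr mxE.
(* By [shift_word], [h] is the only predecessor that can contribute to the sum over [t]. *)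
pose h := nth x0 (wseq (wd i)) m :: take k.-1 (wseq (wd j)).
apply: (@le_trans _ _ (\sum_t ((wseq (wd t) == h) : nat)%:R *
   ((take (k - m.+1) (wseq (wd j)) == drop m.+1 (wseq (wd i))) : nat)%:R)); last first.
  rewrite -mulr_suml ler_piMl ?ler0n //.
  exact: (@sum_inj_le1 _ _ _ predT h (@wd_inj k)).
apply: ler_sum => t _.
apply: (@le_trans _ _ (((take (k - m) (wseq (wd t)) == drop m (wseq (wd i))) : nat)%:R
   * Tk T k t j)).
  by rewrite ler_wpM2r ?IH ?(ltnW mk) // mxE ler0n.
rewrite mxE -!natrM ler_nat !mulnb.
case: eqP => //= tm; case: existsP => //= -[x /eqP jx].
have [tE jE] := shift_word _ _ _ _ x (size_wseq _) (size_wseq _) mk tm.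
by rewrite lt0b /h jx -tE jE !eqxx.
Qed.

Lemma Tk_pow_le1 k (i j : 'I_(nW T k)) : (Tk T k ^+ k) i j <= 1.
Proof.
apply: (le_trans (Tk_pow_entry _ _ _ _ (leqnn k))).
by rewrite -[leRHS]/(1%:R) ler_nat leq_b1.
Qed.

(* On words of length 0 all the E_w coincide, and T_0<C> may have a negative entry. *)
Lemma TkC_bounds k (Cs : {set Wd T k.+2}) i j : 0 <= TkC Cs i j <= Tk T k.+1 i j.
Proof.
rewrite /TkC !mxE summxE.
have E0 w : w \in Cs -> 0 <= Ew T k.+1 (wseq w) i j by rewrite mxE ler0n.
rewrite subr_ge0 gerBl sumr_ge0 // andbT.
(* A word acting at [(i, j)] must be word [i] followed by the last letter of word [j], so at most
   one element of [Cs] acts there. *)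
have E1 (w : Wd T k.+2) : Ew T k.+1 (wseq w) i j <=
    ((wseq w == rcons (wseq (wd i)) (last x0 (wseq (wd j)))) : nat)%:R.
  rewrite mxE ler_nat; case: andP => // -[/eqP -> /eqP ->].
  have := size_wseq w; case/lastP: (wseq w) => // -[//|a s] z _.
  by rewrite size_rcons -{2}cats1 take_size_cat //= last_rcons eqxx.
case: existsP => [_|nx].
  pose s := rcons (wseq (wd i)) (last x0 (wseq (wd j))).
  apply: (@le_trans _ _ (\sum_(w in Cs) ((wseq w == s) : nat)%:R)).
    by apply: ler_sum => w _; apply: E1.
  exact: (sum_inj_le1 _ _ _ _ s (wseq_inj k.+2)).
rewrite big1 // => w _; rewrite mxE; case: andP => // -[/eqP iw /eqP jw].
case: nx; move: iw jw; have := size_wseq w; case/lastP: (wseq w) => // -[//|a s] z _.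
by rewrite size_rcons -{1}cats1 take_size_cat // => -> ->; exists z.
Qed.

Lemma TkC_ge0 k (Cs : {set Wd T k.+2}) i j : 0 <= TkC Cs i j.
Proof. by case/andP: (TkC_bounds _ Cs i j). Qed.

Lemma TkC_le k (Cs : {set Wd T k.+2}) i j : TkC Cs i j <= Tk T k.+1 i j.
Proof. by case/andP: (TkC_bounds _ Cs i j). Qed.

(** [Ew] has rank at most one, so the sum factors into two sums over words, each with at most one
    nonzero term. *)
Lemma sum_Ew_weight k (w : seq 'I_r) (f : 'cV[algC]_(nW T k)) (S : algC) :
  (forall j, 0 <= f j 0) -> (forall j, f j 0 <= S) -> 0 <= S ->
  \sum_i (Ew T k w *m f) i 0 <= S.
Proof.
move=> f0 fS S0.
have -> : \sum_i (Ew T k w *m f) i 0 =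
   (\sum_(i < nW T k) ((wseq (wd i) == take (size w).-1 w) : nat)%:R) *
   (\sum_j ((wseq (wd j) == behead w) : nat)%:R * f j 0).
  rewrite mulr_suml; apply: eq_bigr => i _; rewrite mxE mulr_sumr.
  by apply: eq_bigr => j _; rewrite mxE -mulnb natrM mulrA.
have b1 s : \sum_(j < nW T k) ((wseq (wd j) == s) : nat)%:R <= 1 :> algC.
  exact: (@sum_inj_le1 _ _ _ predT s (@wd_inj k)).
apply: (@le_trans _ _ (1 * S)); last by rewrite mul1r.
apply: ler_pM (b1 _) _.
- by apply: sumr_ge0 => i _; rewrite ler0n.
- by apply: sumr_ge0 => i _; rewrite mulr_ge0 ?ler0n.
apply: (@le_trans _ _ (\sum_j ((wseq (wd j) == behead w) : nat)%:R * S)).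
  by apply: ler_sum => j _; rewrite ler_wpM2l ?ler0n.
by rewrite -mulr_suml ler_piMl.
Qed.

(** The constants depend on [Cs] only through a bound on its size, hence are uniform over all pairs
    of words. *)
Lemma TkC_perturbation (Cs_bound : nat) (v : 'rV[algC]_r) (l0 : algC) :
  v *m Tmx T = l0 *: v -> (forall x, 1 <= v 0 x) -> 1 < l0 ->
  exists C K, 0 < C /\ forall k (Cs : {set Wd T k.+1}) l1,
    (K <= k)%N -> (#|Cs| <= Cs_bound)%N -> PF_eig (TkC Cs) l1 ->
    `|l1 - l0| <= C * l0 ^- k.
Proof.
move=> vT v1 l01; have v0 x : 0 <= v 0 x by apply: le_trans (v1 x).
pose S := \sum_x v 0 x; have vS x : v 0 x <= S.
  by rewrite /S (bigD1 x) //= lerDl sumr_ge0.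
have S0 : 0 < S := lt_le_trans ltr01 (le_trans (v1 x0) (vS x0)).
(* Each removed word costs at most [S]; the successor keeps [c] positive when [Cs_bound] is 0. *)
pose c := Cs_bound.+1%:R * S; have c0 : 0 < c by rewrite mulr_gt0 ?ltr0n.
have [K hK] := perturbed_root l0 c l01 c0.
(* The eigenvector [last_weight] is available for words of length at least 2. *)
exists (2 * c), (maxn K 2); split; first by rewrite mulr_gt0 ?ltr0n.
move=> k Cs l1; rewrite geq_max => /andP[Kk].
case: k Kk Cs => [|[|k]] // Kk Cs _ Csb hl1.
have [b0 hb] := hK _ Kk; set b := l0 - _ in b0 hb.
have l0p : 0 < l0 := lt_trans ltr01 l01.
have bl : b <= l0.
  by rewrite gerBl mulr_ge0 ?invr_ge0 ?exprn_ge0 ?(ltW l0p) // mulr_ge0 ?ler0n ?(ltW c0).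
pose f := last_weight v k.+2.
have fE i : f i 0 = v 0 (last x0 (wseq (wd i))) by rewrite mxE.
have f1 i : 1 <= f i 0 by rewrite fE.
have f0 i : 0 <= f i 0 by rewrite fE.
have Tf : Tk T k.+2 *m f = l0 *: f := Tk_last_weight _ _ _ vT.
pose g := \sum_(w in Cs) Ew T k.+2 (wseq w) *m f.
have Cf : TkC Cs *m f = l0 *: f - g by rewrite mulmxBl Tf mulmx_suml.
have g0 i : 0 <= g i 0.
  rewrite /g summxE; apply: sumr_ge0 => w _; rewrite mxE.
  by apply: sumr_ge0 => j _; rewrite mulr_ge0 // mxE ler0n.
have gc : \sum_i g i 0 <= c.
  under eq_bigr do rewrite /g summxE.
  rewrite exchange_big /=; apply: (@le_trans _ _ (\sum_(w in Cs) S)).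
    apply: ler_sum => w _; apply: sum_Ew_weight => //; last exact: ltW.
    by move=> j; rewrite fE.
  rewrite sumr_const -mulr_natl ler_wpM2r ?(ltW S0) // ler_nat.
  exact: leq_trans Csb _.
have low : b <= l1.
  apply: (@perturbation_lower_bound _ (TkC Cs) (Tk T k.+2) f g k.+2 l0 b c l1) => //.
  - exact: TkC_ge0.
  - exact: TkC_le.
  - exact: Tk_pow_le1.
have up : l1 <= l0.
  have [[z hz <-] _] := hl1.
  apply: (eigenvalue_le _ _ f _ _ (@TkC_ge0 _ Cs)) hz => i.
    exact: lt_le_trans ltr01 (f1 i).
  by rewrite Cf [leLHS]mxE [X in _ + X]mxE [X in X - _]mxE gerBl.
rewrite distrC ger0_norm ?subr_ge0 //.
by rewrite lerBlDr -lerBlDl.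
Qed.

(** A path from [j] to [i] makes the entry [(i, j)] of the power given by its length positive. *)
Lemma Tmx_irreducible : (forall x y : 'I_r, connect (fun a b => T b a) x y) ->
  forall i j, exists m, 0 < (Tmx T ^+ m) i j.
Proof.
have T0 i j : 0 <= Tmx T i j by rewrite mxE ler0n.
move=> irr i j; have /connectP[p pj ->] := irr j i.
exists (size p); elim: p j pj => [|a p IH] j /=; first by rewrite mxE eqxx ltr01.
case/andP=> ja pa; rewrite exprSr mxE (bigD1 a) //= ltr_wpDr //.
  by apply: sumr_ge0 => t _; rewrite mulr_ge0 // exp_mx_ge0.
by rewrite mulr_gt0 ?IH // mxE ja ltr01.
Qed.

End Words.

Theorem theorem5p3 (r : nat) (T : 'M[bool]_r) (l0 : algC) :
  (forall x y : 'I_r, connect (fun a b => T b a) x y) ->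
  PF_eig (Tmx T) l0 -> 1 < l0 ->
  exists (C C' : algC) (N : nat),
    [/\ 0 < C, 0 < C' &
      forall (k : nat) (w1 w2 : Wd T k.+1) (d2 : nat),
        is_d2 T k (behead (wseq w1)) (behead (wseq w2)) d2 ->
        (N <= hw T k (behead (wseq w1)))%N -> (N <= d2)%N ->
        forall l1 : algC, PF_eig (@TkC r T k [set w1; w2]) l1 ->
        `|l1 - l0| <=
          C * l0 ^- k * (1 + C' * l0 ^ ((hw T k (behead (wseq w2)))%:Z - d2%:Z))].
Proof.
move=> irr hl0 l01; have l0p : 0 < l0 := lt_trans ltr01 l01.
have [x0 _] : exists x0 : 'I_r, true.
  by have [[z /eigenvalueP[x _ /rV0Pn[u _]] _] _] := hl0; exists u.
have [|v vT v1] := perron_frobenius _ (Tmx T) l0 _ (Tmx_irreducible _ _ irr) hl0.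
  by move=> i j; rewrite mxE ler0n.
have [C [K [C0 hC]]] := TkC_perturbation _ T x0 2 v l0 vT v1 l01.
(* [hw] searches [k + 1] candidates, so its value is at most [k + 1], and [d_1 >= K + 1] forces
   [k >= K]. *)
exists C, 1, K.+1; split => // k w1 w2 d2 _ Nh _ l1 hl1.
have Kk : (K <= k)%N.
  by rewrite -ltnS; apply: leq_trans Nh _; rewrite (leq_trans (find_size _ _)) ?size_iota.
have hc : (#|[set w1; w2]| <= 2)%N by rewrite cards2; case: (_ != _).
apply: (le_trans (hC _ _ _ Kk hc hl1)); rewrite ler_peMr //.
  by rewrite mulr_ge0 ?invr_ge0 ?exprn_ge0 ?ltW.
by rewrite mul1r lerDl exprz_ge0 // ltW.
Qed.
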